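(* Let $s\ge 2$ be an integer and let $Q^*=(q_{ik})_{0\le i\le s-1,\ k\in\mathbb{N}}$ be a matrix with $q_{ik}>0$, $\sum_{i=0}^{s-1}q_{ik}=1$ for every $k\in\mathbb{N}$, and $\prod_{k=1}^{\infty}\max_{i}q_{ik}=0$. Let $q_k:=\max_{0\le i\le s-1} q_{ik}$ and, for $\delta>0$ and integers $m\ge 0$, let $$S(m,\delta):=\sum_{k=1}^{\infty}\left(\prod_{i=m+1}^{m+k}q_i\right)^{\delta},\qquad S(\delta):=\sup_{m}S(m,\delta).$$ If $S(\delta)<+\infty$ for every $\delta>0$, then the family $\varPhi(Q^* )$ of cylinders of the $Q^*$-expansion is faithful for the calculation of the Hausdorff dimension on the unit interval, that is, $$\dim_H(E)=\dim_H\bigl(E,\varPhi(Q^* )\bigr)\quad\text{for every } E\subset[0,1].$$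
   Context: $\mathbb{N}=\{1,2,3,\dots\}$. Cylinders of the $Q^*$-expansion: for $n\ge1$ and $\alpha_1,\dots,\alpha_n\in\{0,\dots,s-1\}$, the cylinder $\varDelta_{\alpha_1\dots\alpha_n}$ of rank $n$ is the closed interval defined recursively as follows. $[0,1]$ is divided, from left to right, into $s$ consecutive closed intervals $\varDelta_0,\dots,\varDelta_{s-1}$ (adjacent ones sharing an endpoint) with lengths $|\varDelta_i|=q_{i1}$; each cylinder $\varDelta_{\alpha_1\dots\alpha_n}$ of rank $n$ is divided, from left to right, into $s$ consecutive closed intervals $\varDelta_{\alpha_1\dots\alpha_n 0},\dots,\varDelta_{\alpha_1\dots\alpha_n(s-1)}$ with $|\varDelta_{\alpha_1\dots\alpha_n i}|=q_{i(n+1)}|\varDelta_{\alpha_1\dots\alpha_n}|$. Thus $|\varDelta_{\alpha_1\dots\alpha_n}|=\prod_{k=1}^n q_{\alpha_k k}$. $\varPhi(Q^* )$ denotes the family of all cylinders of all ranks. Hausdorff dimension with respect to a family: for a family $\varPhi$ of subsets of $[0,1]$ such that for every $\varepsilon>0$ the interval $[0,1]$ can be covered by at most countably many members of $\varPhi$ of diameter at most $\varepsilon$, for $E\subset[0,1]$ and $\alpha>0$ put $$H^{\alpha}(E,\varPhi)=\lim_{\varepsilon\to0}\ \inf\Bigl\{\sum_j|E_j|^{\alpha}\Bigr\},$$ where $|E_j|$ is the diameter of $E_j$ and the infimum is over all at most countable coverings $\{E_j\}$ of $E$ with $E_j\in\varPhi$, $|E_j|\le\varepsilon$. Put $\dim_H(E,\varPhi)=\inf\{\alpha: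 H^{\alpha}(E,\varPhi)=0\}$. When $\varPhi$ is the family of all subsets of $[0,1]$ this is the classical Hausdorff dimension $\dim_H(E)$. *)

(* Defs.v *)
From HB Require Import structures.
From mathcomp Require Import all_boot all_order all_algebra.
From mathcomp Require Import all_classical all_reals all_analysis.

Set Implicit Arguments.
Unset Strict Implicit.
Unset Printing Implicit Defensive.

Import Order.TTheory GRing.Theory Num.Theory.
Import numFieldNormedType.Exports.

Local Open Scope classical_set_scope.
Local Open Scope ring_scope.

Section HausdorffDimension.
Variable R : realType.
Implicit Types (A E : set R) (Phi : set (set R)) (a eps : R).

(* [sup] is real-valued: this is the diameter of A when A is bounded, and it
   is 0 when A is empty. *)
Definition diam A : R := sup [set `|x - y| | x in A & y in A].

(* The covering is indexed by an arbitrary J : set nat, so that finite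
   coverings are allowed even if Phi does not contain the empty set. The
   infimum is +oo if there is no covering. *)
Definition hausdorff_pre Phi a E eps : \bar R :=
  ereal_inf [set t | exists (J : set nat) (C : nat -> set R),
    [/\ forall j, J j -> Phi (C j) /\ diam (C j) <= eps,
        E `<=` \bigcup_(j in J) C j
      & t = \esum_(j in J) ((diam (C j)) `^ a)%:E]].

Definition hausdorff_measure Phi a E : \bar R :=
  lim (hausdorff_pre Phi a E eps @[eps --> 0^'+]).

Definition hausdorff_dim_wrt Phi E : \bar R :=
  ereal_inf [set a%:E | a in [set a : R |
    0 < a /\ hausdorff_measure Phi a E = 0%E]].

Definition unit_subsets : set (set R) := [set A | A `<=` `[0, 1]].

Definition hausdorff_dim E : \bar R := hausdorff_dim_wrt unit_subsets E.

Definition faithful_family Phi : Prop :=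
  forall E, E `<=` `[0, 1] -> hausdorff_dim E = hausdorff_dim_wrt Phi E.

End HausdorffDimension.

(* The columns of the matrix q are indexed by k = 1, 2, ...; the values q i 0
   are never used. Likewise, a cylinder of rank n is given by a sequence of
   digits alpha of which only alpha 1, ..., alpha n are used. *)
Section Qstar.
Variables (R : realType) (s : nat) (q : 'I_s -> nat -> R).
Implicit Types (alpha : nat -> 'I_s) (n m k : nat) (d : R).

Fixpoint cyl_length alpha n : R :=
  if n is n'.+1 then q (alpha n) n * cyl_length alpha n' else 1.

Fixpoint cyl_left alpha n : R :=
  if n is n'.+1 then
    cyl_left alpha n' +
      \sum_(i < s | (i < alpha n)%N) q i n * cyl_length alpha n'
  else 0.

Definition cylinder alpha n : set R :=
  `[cyl_left alpha n, cyl_left alpha n + cyl_length alpha n].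

Definition cylinders : set (set R) :=
  [set A | exists alpha n, (1 <= n)%N /\ A = cylinder alpha n].

(* The default value 0 is harmless as the entries of q are positive. *)
Definition qmax k : R := \big[Num.max/0]_(i < s) q i k.

Definition Ssum m d : \bar R :=
  (\sum_(1 <= k <oo) ((\prod_(m.+1 <= i < (m + k).+1) qmax i) `^ d)%:E)%E.

Definition Ssup d : \bar R := ereal_sup [set Ssum m d | m in [set: nat]].

End Qstar.

(* Main.v *)
Require Import Defs.
From mathcomp Require Import all_boot all_order all_algebra.
From mathcomp Require Import all_classical all_reals all_analysis.
From mathcomp Require Import ring lra.

(** Every cylinder is a subset of [0, 1], so coverings by cylinders compete in
    the classical definition, and the classical dimension is the smaller one.
    For the converse let the a-dimensional Hausdorff measure of E vanish and
    let d > 0; it suffices that the (a + d)-dimensional measure with respect to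
    the cylinders vanishes too ([hausdorff_measure_cylinders_eq0]). This
    reduces to one covering set: a set E of diameter at most r < 1 has a
    covering by cylinders of length at most r whose sum of (a + d)-th powers is
    at most C r^a, where C depends only on d and on the matrix
    ([hausdorff_pre_cylinders_le]).

    Such a covering is obtained by a stopping rule. Enclose E in [x, x + r].
    Each z in E has a digit sequence; stop it at the first rank n + 1 at which
    its cylinder has length at most r, which happens because the maximal length
    P_n := q_1 ... q_n of a cylinder of rank n tends to 0. The parent, of rank
    n, is longer than r and meets an interval of length r, so its digits are
    the first n digits of one of the two endpoints ([greedy_endpoint],
    [greedy_unique]). Hence at most 2s cylinders are stopped at rank n + 1.
    Moreover a parent of rank n that is longer than r forces r < P_n, so each
    stopped cylinder contributes at most r^(a + d) <= r^a P_n^d. Summing over n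
    gives 2s r^a (1 + S(0, d)), which is finite because S(d) is. *)

Set Implicit Arguments.
Unset Strict Implicit.
Unset Printing Implicit Defensive.

Import Order.TTheory GRing.Theory Num.Theory.
Import numFieldNormedType.Exports.

Local Open Scope classical_set_scope.
Local Open Scope ring_scope.

(** * Coverings by members of a family *)

Section Premeasure.
Context {R : realType}.
Implicit Types (A E : set R) (Phi Psi : set (set R)) (a eps : R).

Lemma hausdorff_pre_ge0 Phi a E eps : (0 <= hausdorff_pre Phi a E eps)%E.
Proof.
apply: le_ereal_inf_tmp => _ [J [C [_ _ ->]]].
by apply: esum_ge0 => j _; rewrite lee_fin powR_ge0.
Qed.

Lemma hausdorff_pre_le Phi Psi a E eps1 eps2 :
  Phi `<=` Psi -> eps1 <= eps2 ->
  (hausdorff_pre Psi a E eps2 <= hausdorff_pre Phi a E eps1)%E.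
Proof.
move=> PhiPsi le_eps; apply: ereal_inf_le_tmp => _ [J [C [CJ EC ->]]].
exists J, C; split=> // j /CJ[Cj dj]; split; first exact: PhiPsi.
exact: le_trans dj le_eps.
Qed.

(** The premeasures are nonnegative and grow as eps decreases, so their limit
    is 0 only if all of them are. In this form measure zero is stated without
    limits. *)
Lemma hausdorff_measure_eq0 Phi a E :
  hausdorff_measure Phi a E = 0%E <->
  (forall eps, 0 < eps -> hausdorff_pre Phi a E eps = 0%E).
Proof.
split=> [H0 eps eps0|pre0]; last first.
  apply: lim_near_cst => //; near=> eps; apply: pre0.
  by near: eps; exact: nbhs_right_gt.
have : hausdorff_pre Phi a E e @[e --> 0^'+] -->
    ereal_sup (hausdorff_pre Phi a E @` [set` Interval (BRight (0:R)) +oo%O]).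
  apply: nonincreasing_at_right_cvge => // x y _ _ xy.
  exact: hausdorff_pre_le.
move/cvg_lim => lim_pre.
apply/eqP; rewrite eq_le hausdorff_pre_ge0 andbT -H0 /hausdorff_measure.
rewrite lim_pre //; apply: ereal_sup_ubound; exists eps => //=.
by rewrite in_itv/= eps0.
Unshelve. all: by end_near. Qed.

(** Coverings come indexed by pairs and triples below; [pickle] turns such an
    index set into a set of natural numbers. *)
Lemma hausdorff_pre_le_esum (T : countType) (K : set T) (C : T -> set R)
    Phi a E eps :
  (forall k, K k -> Phi (C k) /\ diam (C k) <= eps) ->
  E `<=` \bigcup_(k in K) C k ->
  (hausdorff_pre Phi a E eps <= \esum_(k in K) (diam (C k) `^ a)%:E)%E.
Proof.
move=> PhiC EC; pose D n := oapp C set0 (unpickle n).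
have DK k : D (pickle k) = C k by rewrite /D pickleK.
apply: ereal_inf_lbound; exists (pickle @` K), D; split.
- by move=> _ [k Kk <-]; rewrite DK; exact: PhiC.
- move=> x /EC[k Kk Ckx]; exists (pickle k); first by exists k.
  by rewrite DK.
- rewrite esum_image; first by apply: eq_esum => k _; rewrite DK.
  by move=> x y _ _ /(pcan_inj pickleK).
Qed.

(** Countable subadditivity of the premeasure. The strict bounds spare the
    usual eps / 2^j correction: each C j has a covering whose sum is below
    c j, and the union of these coverings covers E. *)
Lemma hausdorff_pre_bigcup Phi a E eps (J : set nat) (C : nat -> set R)
    (c : nat -> \bar R) :
  E `<=` \bigcup_(j in J) C j ->
  (forall j, J j -> (hausdorff_pre Phi a (C j) eps < c j)%E) ->
  (hausdorff_pre Phi a E eps <= \esum_(j in J) c j)%E.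
Proof.
move=> EC Cc.
have /choice[W /= WP] j : exists w : set nat * (nat -> set R), J j ->
    [/\ forall i, w.1 i -> Phi (w.2 i) /\ diam (w.2 i) <= eps,
        C j `<=` \bigcup_(i in w.1) w.2 i
      & (\esum_(i in w.1) (diam (w.2 i) `^ a)%:E < c j)%E].
  have [Jj|nJj] := pselect (J j); last by exists (set0, fun=> set0).
  have [_ [I [D [PhiD CD ->]]] lt_c] := ereal_inf_lt (Cc j Jj).
  by exists (I, D) => _; split.
pose K : set (nat * nat) := J `*`` (fun j => (W j).1).
apply: le_trans (_ : _ <= \esum_(k in K) (diam ((W k.1).2 k.2) `^ a)%:E)%E _.
  apply: hausdorff_pre_le_esum => [[j i] [/= Jj Wji]|x /EC[j Jj Cjx]].
    by have [+ _ _] := WP j Jj; exact.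
  have [_ /(_ x Cjx)[i Wi Dix] _] := WP j Jj.
  by exists (j, i).
rewrite -(@esum_esum _ _ _ J (fun j => (W j).1)
  (fun j i => (diam ((W j).2 i) `^ a)%:E)); last first.
  by move=> j i _ _; rewrite lee_fin powR_ge0.
by apply: le_esum => j /WP[_ _ /ltW].
Qed.

End Premeasure.

(** * Auxiliary sums and intervals *)

Lemma esum_finType_cst {R : realType} (T : finType) (c : R) : 0 <= c ->
  (\esum_(i in [set: T]) c%:E = (#|T|%:R * c)%:E)%E.
Proof.
move=> c0; rewrite esum_fset; [|exact: finite_finset|by move=> i _; rewrite lee_fin].
rewrite (@fsbigE _ _ _ _ _ (enum T)) ?enum_uniq//; last first.
  by move=> i _; rewrite mem_enum.
rewrite big_mkcond/= big_enum/=.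
under eq_bigr do rewrite in_setT.
by rewrite sumEFin sumr_const mulr_natl.
Qed.

Lemma esumZl_nat {R : realType} (J : set nat) (x : R) (f : nat -> \bar R) :
  0 <= x -> (forall j, 0 <= f j)%E ->
  (\esum_(j in J) (x%:E * f j) = x%:E * \esum_(j in J) f j)%E.
Proof.
move=> x0 f0; rewrite !(esum_mkcond J) -!nneseries_esumT; last 2 first.
- by move=> j; case: ifP.
- by move=> j; case: ifP => // _; rewrite mule_ge0.
rewrite -nneseriesZl; last by move=> j _; case: ifP.
by apply: eq_eseriesr => j _; case: ifP => // _; rewrite mule0.
Qed.

Section Interval.
Context {R : realType}.

Lemma diam_itv (x y : R) : x <= y -> diam `[x, y] = y - x.
Proof.
move=> xy; apply/le_anti/andP; split.
  apply: ge_sup.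
    exists `|x - x|, x; first by rewrite /= in_itv/= lexx.
    by exists x => //; rewrite /= in_itv/= lexx.
  move=> _ [u + [v + <-]]; rewrite /= !in_itv/= => /andP[xu uy] /andP[xv vy].
  by rewrite ler_norml; apply/andP; split; rewrite ?opprB; apply: lerB.
apply: ub_le_sup.
  exists (y - x) => _ [u + [v + <-]].
  rewrite /= !in_itv/= => /andP[xu uy] /andP[xv vy].
  by rewrite ler_norml; apply/andP; split; rewrite ?opprB; apply: lerB.
exists y; first by rewrite /= in_itv/= xy lexx.
by exists x; [rewrite /= in_itv/= xy lexx|rewrite ger0_norm ?subr_ge0].
Qed.

Lemma sub_itv_diam (E : set R) (r : R) : E `<=` `[0, 1] -> diam E <= r ->
  exists2 x, 0 <= x & E `<=` `[x, x + r].
Proof.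
move=> E01 dr; have [->|/set0P[z0 Ez0]] := eqVneq E set0; first by exists 0.
have itvE z : E z -> 0 <= z <= 1 by move/E01; rewrite /= in_itv.
have lb0 : lbound E 0 by move=> z /itvE/andP[].
exists (inf E); first by apply: lb_le_inf => //; exists z0.
move=> z Ez; rewrite /= in_itv/= -lerBlDr; apply/andP; split.
  by apply: ge_inf => //; exists 0.
apply: lb_le_inf; first by exists z0.
move=> w Ew; rewrite lerBlDr addrC -lerBlDr; apply: le_trans dr.
apply: le_trans (ler_norm _) _; apply: ub_le_sup; last by exists z => //; exists w.
exists 1 => _ [u /itvE/andP[u0 u1] [v /itvE/andP[v0 v1] <-]].
by rewrite ler_norml; lra.
Qed.

End Interval.

(** * Cylinders and greedy digits *)

Section Cylinders.
Context {R : realType} {s : nat} {q : 'I_s -> nat -> R}.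
Hypothesis q_gt0 : forall i k, (1 <= k)%N -> 0 < q i k.
Hypothesis q_sum : forall k, (1 <= k)%N -> \sum_(i < s) q i k = 1.
Implicit Types (alpha beta : nat -> 'I_s) (n k : nat) (x y z : R).

Local Notation left := (cyl_left q).
Local Notation length := (cyl_length q).
Local Notation right alpha n := (left alpha n + length alpha n).

Lemma cyl_length_gt0 alpha n : 0 < length alpha n.
Proof. by elim: n => //= n IH; rewrite mulr_gt0// q_gt0. Qed.

Lemma eq_cyl alpha beta n : (forall k, (1 <= k <= n)%N -> alpha k = beta k) ->
  left alpha n = left beta n /\ length alpha n = length beta n.
Proof.
elim: n => //= n IH eq_ab; rewrite eq_ab ?leqnn//.
have [k /andP[k1 kn]|-> -> //] := IH.
by apply: eq_ab; rewrite k1 ltnW.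
Qed.

Lemma cyl_rightS alpha n : right alpha n.+1 =
  left alpha n + (\sum_(i < s | (i <= alpha n.+1)%N) q i n.+1) * length alpha n.
Proof.
rewrite /= -mulr_suml -addrA -mulrDl; congr (_ + _ * _).
rewrite [RHS](bigD1 (alpha n.+1))//= addrC; congr (_ + _).
by apply: eq_bigl => i; rewrite ltn_neqAle andbC.
Qed.

Lemma cyl_left_leS alpha n : left alpha n <= left alpha n.+1.
Proof.
rewrite /= lerDl sumr_ge0// => i _.
by rewrite mulr_ge0 ?ltW ?q_gt0 ?cyl_length_gt0.
Qed.

Lemma cyl_right_leS alpha n : right alpha n.+1 <= right alpha n.
Proof.
rewrite cyl_rightS lerD2l ger_pMl ?cyl_length_gt0// -(q_sum (ltn0Sn n)).
rewrite [leRHS](bigID (fun i : 'I_s => (i <= alpha n.+1)%N))/= lerDl.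
by rewrite sumr_ge0// => i _; rewrite ltW ?q_gt0.
Qed.

Lemma cyl_right_last alpha n : (alpha n.+1).+1 = s ->
  right alpha n.+1 = right alpha n.
Proof.
move=> last; rewrite cyl_rightS -[X in _ = _ + X]mul1r -(q_sum (ltn0Sn n)).
congr (_ + _ * _); apply: eq_bigl => i.
by rewrite -ltnS last ltn_ord.
Qed.

Lemma cyl_left_homo alpha : {homo left alpha : m n / (m <= n)%N >-> m <= n}.
Proof. by apply: homo_leq => // [x y z|n]; [exact: le_trans|exact: cyl_left_leS]. Qed.

Lemma cyl_right_homo alpha m n : (m <= n)%N -> right alpha n <= right alpha m.
Proof.
elim: n => [|n IH]; first by rewrite leqn0 => /eqP ->.
rewrite leq_eqVlt ltnS => /predU1P[->//|/IH]; apply: le_trans.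
exact: cyl_right_leS.
Qed.

Lemma cylinder_sub01 alpha n : cylinder q alpha n `<=` `[0, 1].
Proof.
move=> x; rewrite /cylinder /= !in_itv/= => /andP[lx xr]; apply/andP; split.
  exact: le_trans (cyl_left_homo alpha (leq0n n)) lx.
by apply: le_trans xr (le_trans (cyl_right_homo alpha (leq0n n)) _); rewrite /= add0r.
Qed.

Lemma diam_cylinder alpha n : diam (cylinder q alpha n) = length alpha n.
Proof. by rewrite diam_itv ?lerDl ?ltW ?cyl_length_gt0// addrC addKr. Qed.

Lemma cyl_length_le_prod alpha n :
  length alpha n <= \prod_(1 <= i < n.+1) qmax q i.
Proof.
elim: n => [|n IH]; first by rewrite big_nil.
rewrite big_nat_recr//= mulrC; apply: ler_pM => //.
- exact/ltW/cyl_length_gt0.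
- exact/ltW/q_gt0.
- exact: (le_bigmax 0 (fun i => q i n.+1)).
Qed.

(** The first n digits of alpha are those of y, where a point shared by two
    cylinders belongs to the right one: at each rank the digit is the largest
    one whose cylinder starts at or before y. The last digit is exempt from the
    upper bound, so that y >= 1 is allowed and gets only last digits; this is
    needed because the right end of an interval covering a subset of [0, 1] may
    exceed 1. *)
Definition greedy alpha n (y : R) := forall k, (1 <= k <= n)%N ->
  left alpha k <= y /\ ((alpha k).+1 = s \/ y < right alpha k).

Lemma greedy_left alpha n y : 0 <= y -> greedy alpha n y -> left alpha n <= y.
Proof. by case: n => // n _ /(_ n.+1)[]; rewrite // ltnS leqnn. Qed.

Lemma greedyW alpha m n y : (m <= n)%N -> greedy alpha n y -> greedy alpha m y.
Proof.
by move=> mn gn k /andP[k1 km]; apply: gn; rewrite k1 (leq_trans km).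
Qed.

(** A digit other than the last one bounds y directly. The last digit keeps
    the right end of the parent, so there the bound comes from the previous
    rank, and ultimately from y <= 1. *)
Lemma greedy_right alpha n y : y <= 1 -> greedy alpha n y -> y <= right alpha n.
Proof.
elim: n => [|n IH] y1 g; first by rewrite /= add0r.
have [|_ [/cyl_right_last ->|/ltW//]] := g n.+1; first by rewrite ltnS leqnn.
by apply: IH => //; apply: greedyW g.
Qed.

Definition prolong alpha n (i : 'I_s) : nat -> 'I_s :=
  fun k => if (k <= n)%N then alpha k else i.

Lemma greedy_exists n y : (0 < s)%N -> 0 <= y -> exists alpha, greedy alpha n y.
Proof.
move=> s0 y0; elim: n => [|n [alpha g]].
  by exists (fun=> Ordinal s0) => k; case: k.
pose child_left (i : nat) :=
  left alpha n + \sum_(j < s | (j < i)%N) q j n.+1 * length alpha n.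
have P0 : child_left (Ordinal s0) <= y.
  by rewrite /child_left big1 ?addr0//; apply: greedy_left.
case: (@arg_maxnP _ _ (fun i : 'I_s => child_left i <= y) (@nat_of_ord s) P0).
move=> i iy imax; exists (prolong alpha n i) => k /andP[k1].
have eq_pre m : (m <= n)%N -> forall j, (1 <= j <= m)%N ->
    prolong alpha n i j = alpha j.
  by move=> mn j /andP[_ jm]; rewrite /prolong (leq_trans jm).
have eqn := eq_cyl (eq_pre _ (leqnn n)).
have di : prolong alpha n i n.+1 = i by rewrite /prolong ltnn.
rewrite leq_eqVlt ltnS => /predU1P[->|kn]; last first.
  have [-> ->] := eq_cyl (eq_pre _ kn).
  by rewrite (eq_pre _ kn) ?k1 ?leqnn//; apply: g; rewrite k1.
rewrite cyl_rightS /= di !eqn.1 !eqn.2; split=> //.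
have [si|] := eqVneq i.+1 s; first by left.
rewrite neq_ltn => /orP[si|]; last by rewrite ltnS leqNgt ltn_ord.
right; rewrite ltNge.
apply/negP => yi; have := imax (Ordinal si).
by rewrite /child_left/= -mulr_suml => /(_ yi); rewrite ltnn.
Qed.

(** If the digits first differ at rank m + 1, the cylinder with the smaller
    digit ends at or before the start of the other one, hence at or before y;
    its digit is not the last one, so this contradicts the upper bound. *)
Lemma greedy_unique alpha beta n y : greedy alpha n y -> greedy beta n y ->
  forall k, (1 <= k <= n)%N -> alpha k = beta k.
Proof.
have digit_le m a b : greedy a m.+1 y -> greedy b m.+1 y ->
    (forall k, (1 <= k <= m)%N -> a k = b k) -> (b m.+1 <= a m.+1)%N.
  move=> ga gb eq_ab; have m1 : (1 <= m.+1 <= m.+1)%N by rewrite /= leqnn.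
  have [[_ ya] [yb _]] := (ga _ m1, gb _ m1).
  rewrite leqNgt; apply/negP => lt_ab.
  case: ya => [sa|].
    by have := leq_ltn_trans lt_ab (ltn_ord (b m.+1)); rewrite sa ltnn.
  apply/negP; rewrite -leNgt; apply: le_trans yb.
  have [el er] := eq_cyl eq_ab.
  rewrite cyl_rightS /= el er -mulr_suml lerD2l.
  apply: ler_wpM2r; first exact/ltW/cyl_length_gt0.
  rewrite big_mkcond [leRHS]big_mkcond; apply: ler_sum => i _.
  have [ia|_] := leqP i (a m.+1); first by rewrite (leq_ltn_trans ia lt_ab).
  by case: ifP => // _; apply/ltW/q_gt0.
elim: n => [|n IH] ga gb k /andP[k1]; first by rewrite leqNgt k1.
have eq_ab := IH (greedyW (leqnSn n) ga) (greedyW (leqnSn n) gb).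
rewrite leq_eqVlt ltnS => /predU1P[->|kn]; last by apply: eq_ab; rewrite k1.
apply/val_inj/anti_leq/andP; split; apply: digit_le => // j jn.
by rewrite eq_ab.
Qed.

(** A cylinder longer than y - x cannot both start after x and end at or before
    y. In the first case below x inherits the digits of z because only its
    lower bounds are at stake, in the second y does because only its upper
    bounds are. *)
Lemma greedy_endpoint alpha n x y z : x <= z <= y -> y - x < length alpha n ->
  greedy alpha n z -> greedy alpha n x \/ greedy alpha n y.
Proof.
move=> /andP[xz zy] long g; have [lx|xl] := leP (left alpha n) x.
  left=> k /andP[k1 kn]; have [|_ last_or_lt] := g k; first by rewrite k1.
  split; first exact: le_trans (cyl_left_homo _ kn) lx.
  by case: last_or_lt => [|zr]; [left|right; apply: le_lt_trans zr].
right=> k /andP[k1 kn]; have [|lz _] := g k; first by rewrite k1.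
split; first exact: le_trans zy.
by right; apply: lt_le_trans (cyl_right_homo alpha kn); lra.
Qed.

End Cylinders.
Arguments greedy {R s} q alpha n y.

(** * Comparison of the premeasures *)

Section Comparison.
Context {R : realType} {s : nat} {q : 'I_s -> nat -> R}.
Hypothesis s_gt0 : (0 < s)%N.
Hypothesis q_gt0 : forall i k, (1 <= k)%N -> 0 < q i k.
Hypothesis q_sum : forall k, (1 <= k)%N -> \sum_(i < s) q i k = 1.
Hypothesis q_prod :
  (\prod_(1 <= k < n.+1) qmax q k) @[n --> \oo] --> (0 : R).

Local Notation maxlen n := (\prod_(1 <= k < n.+1) qmax q k).

(** The stopping argument. The covering is indexed by the rank n of the parent,
    a boolean telling which endpoint of [x, x + r] has the same first n digits
    as the parent, and the digit leading to the stopped cylinder. *)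
Lemma hausdorff_pre_cylinders_le (a d r : R) (E : set R) :
  0 <= a -> 0 <= d -> 0 < r < 1 -> E `<=` `[0, 1] -> diam E <= r ->
  (hausdorff_pre (cylinders q) (a + d) E r <=
   ((2 * s)%:R * r `^ a)%:E * \sum_(0 <= n <oo) (maxlen n `^ d)%:E)%E.
Proof.
move=> a0 d0 /andP[r0 r1] E01 dE.
have [x x0 Ex] := sub_itv_diam E01 dE.
have /choice[beta betaP] (nb : nat * bool) :
    exists alpha, greedy q alpha nb.1 (x + (if nb.2 then r else 0)).
  by apply: greedy_exists => //; rewrite addr_ge0//; case: ifP => // _; apply: ltW.
pose child (k : nat * (bool * 'I_s)) := prolong (beta (k.1, k.2.1)) k.1 k.2.2.
pose K := [set k : nat * (bool * 'I_s) |
  r < cyl_length q (beta (k.1, k.2.1)) k.1 /\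
  cyl_length q (child k) k.1.+1 <= r].
apply: le_trans (_ : _ <= \esum_(k in K)
    (diam (cylinder q (child k) k.1.+1) `^ (a + d))%:E)%E _.
  apply: hausdorff_pre_le_esum => [k [_ kr]|z Ez].
    by rewrite diam_cylinder//; split=> //; exists (child k), k.1.+1.
  have /andP[z0 z1] : 0 <= z <= 1 by have := E01 _ Ez; rewrite /= in_itv.
  have xzr : x <= z <= x + r by have := Ex _ Ez; rewrite /= in_itv.
  have [N _ /(_ N (leqnn N)) PN] : \forall n \near \oo, maxlen n < r.
    exact: cvgr_lt q_prod _ r0.
  have [alpha g] := greedy_exists (q := q) N s_gt0 z0.
  have Nr : cyl_length q alpha N <= r.
    exact: le_trans (cyl_length_le_prod q_gt0 _ _) (ltW PN).
  have exr : exists n, cyl_length q alpha n <= r by exists N.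
  (* The rank of the stopped cylinder is not 0, as [0, 1] is longer than r. *)
  case: (ex_minnP exr) => -[|n] nr nmin; first by move: nr; rewrite /= leNgt r1.
  have {}g : greedy q alpha n.+1 z := greedyW (nmin _ Nr) g.
  have gn := greedyW (leqnSn n) g.
  have rn : r < cyl_length q alpha n.
    by rewrite ltNge; apply/negP => /nmin; rewrite ltnn.
  have [b eqb] : exists b, forall k, (1 <= k <= n)%N -> beta (n, b) k = alpha k.
    have long : x + r - x < cyl_length q alpha n by rewrite addrC addKr.
    have [gx|gr] := greedy_endpoint q_gt0 q_sum xzr long gn.
      have := betaP (n, false); rewrite /= addr0 => gb.
      by exists false; exact: (greedy_unique q_gt0 gb gx).
    by exists true; exact: (greedy_unique q_gt0 (betaP (n, true)) gr).
  have eqchild k : (1 <= k <= n.+1)%N ->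
      child (n, (b, alpha n.+1)) k = alpha k.
    rewrite /child /prolong/= => /andP[k1 kn].
    have [kn'|nk] := leqP k n.
      by apply: eqb; rewrite k1.
    by congr alpha; apply/anti_leq; rewrite nk kn.
  have [el er] := eq_cyl (q := q) eqchild.
  exists (n, (b, alpha n.+1)); first split=> /=.
  - by have [_ ->] := eq_cyl (q := q) eqb.
  - by rewrite -/(cyl_length q _ n.+1) er.
  rewrite /cylinder [_.1]/= el er /= in_itv; apply/andP; split.
    exact: (greedy_left z0 g).
  exact: (greedy_right q_sum z1 g).
(* r < P_n for each parent of rank n: this trades r^d for P_n^d. *)
pose bound n : R := r `^ a * maxlen n `^ d.
apply: le_trans (_ : _ <= \esum_(k in [set: nat] `*`` (fun=> [set: bool * 'I_s]))
    (bound k.1)%:E)%E _.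
  rewrite esum_mkcond [leRHS]esum_mkcond; apply: le_esum => k _.
  rewrite [k \in _ `*`` _]mem_set//; case: ifPn => [|_]; last first.
    by rewrite lee_fin mulr_ge0 ?powR_ge0.
  rewrite inE => -[rk kr]; rewrite lee_fin diam_cylinder//.
  apply: le_trans (_ : r `^ (a + d) <= _).
    apply: ge0_ler_powR; rewrite ?addr_ge0// nnegrE ltW//.
    exact: cyl_length_gt0.
  rewrite powRD ?(gt_eqF r0) ?implybT// ler_wpM2l ?powR_ge0//.
  have rP : r <= maxlen k.1.
    exact: le_trans (ltW rk) (cyl_length_le_prod q_gt0 _ _).
  by apply: ge0_ler_powR; rewrite ?nnegrE ?(ltW r0)// (le_trans (ltW r0)).
rewrite -(@esum_esum _ _ _ setT (fun=> setT) (fun n _ => (bound n)%:E)); last first.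
  by move=> n k _ _; rewrite lee_fin mulr_ge0 ?powR_ge0.
under eq_esum => n _.
  rewrite esum_finType_cst; last by rewrite mulr_ge0 ?powR_ge0.
  rewrite card_prod card_bool card_ord /bound mulrA EFinM.
  over.
rewrite -nneseries_esumT; last first.
  by move=> n; rewrite mule_ge0 ?lee_fin ?mulr_ge0 ?powR_ge0.
by rewrite nneseriesZl// => n _; rewrite lee_fin powR_ge0.
Qed.

Lemma series_maxlen (d : R) :
  (\sum_(0 <= n <oo) (maxlen n `^ d)%:E = 1 + Ssum q 0 d)%E.
Proof.
rewrite nneseries_recl; [|by move=> n _; rewrite lee_fin powR_ge0|by []].
by rewrite big_nil powR1.
Qed.

(** Given a covering by arbitrary sets C j with small sum of a-th powers, cover
    each C j by cylinders. A set of diameter 0 admits no cylinder of length at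
    most its diameter, so the scale used for C j is a positive number r j, at
    least the diameter, whose a-th power exceeds that of the diameter by at most
    h / 2^(j + 1). *)
Lemma hausdorff_measure_cylinders_eq0 (a d : R) (E : set R) :
  0 < a -> 0 < d -> (Ssum q 0 d < +oo)%E ->
  hausdorff_measure (@unit_subsets R) a E = 0%E ->
  hausdorff_measure (cylinders q) (a + d) E = 0%E.
Proof.
move=> a0 d0 Sfin /hausdorff_measure_eq0 pre0.
apply/hausdorff_measure_eq0 => eps eps0.
apply/eqP; rewrite eq_le hausdorff_pre_ge0 andbT.
apply/lee_addgt0Pr => eta eta0; rewrite add0e.
have S0 : (0 <= Ssum q 0 d)%E.
  by apply: nneseries_ge0 => n _ _; rewrite lee_fin powR_ge0.
have [M [M0 SM]] : exists M : R, 0 <= M /\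
    (\sum_(0 <= n <oo) (maxlen n `^ d)%:E = M%:E)%E.
  exists (1 + fine (Ssum q 0 d)); split; first by rewrite addr_ge0// fine_ge0.
  by rewrite series_maxlen EFinD fineK// ge0_fin_numE.
(* The summand 1 makes the bounds on the sets C j strict. *)
pose L : R := (2 * s)%:R * M + 1.
have L0 : 0 < L by rewrite ltr_wpDl// mulr_ge0.
(* 1 / 2 keeps the scales r j below 1, where the stopping argument applies. *)
pose e := Num.min eps 2^-1.
have e0 : 0 < e by rewrite lt_min eps0 invr_gt0 ltr0n.
have [e_eps e1] : e <= eps /\ e < 1.
  split; first by rewrite ge_min lexx.
  by rewrite gt_min invf_lt1 ?ltr1n ?orbT.
(* Half of eta / L goes to the given covering, half to the passage to r j. *)
pose h : R := eta / (2 * L).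
have h0 : 0 < h by rewrite divr_gt0// mulr_gt0.
have : (hausdorff_pre (@unit_subsets R) a E e < h%:E)%E by rewrite pre0 ?lte_fin.
move=> /ereal_inf_lt[_ [J [C [CJ EC ->]]] sumC].
pose w j : R := h / (2 ^ j.+1)%:R.
have w0 j : 0 < w j by rewrite divr_gt0// ltr0n expn_gt0.
pose r j : R := Num.max (diam (C j)) (Num.min e (w j `^ a^-1)).
have r0 j : 0 < r j by rewrite lt_max lt_min e0 powR_gt0 ?orbT.
have re j : J j -> r j <= e by move=> /CJ[_ dj]; rewrite ge_max dj ge_min lexx.
have ra j : r j `^ a <= diam (C j) `^ a + w j.
  rewrite /r; case: (leP (diam (C j))) => _; last by rewrite lerDl ltW.
  apply: le_trans (_ : (w j `^ a^-1) `^ a <= _).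
    apply: ge0_ler_powR; rewrite ?nnegrE ?powR_ge0//; first exact: ltW.
      by rewrite le_min powR_ge0 ltW.
    by rewrite ge_min lexx orbT.
  rewrite -powRrM mulVf ?gt_eqF// powRr1; last exact: ltW.
  by rewrite lerDr powR_ge0.
apply: le_trans (hausdorff_pre_bigcup (c := fun j => (L * r j `^ a)%:E) EC _) _.
  move=> j Jj; have [Cj01 dj] := CJ j Jj.
  apply: le_lt_trans (hausdorff_pre_le _ _ _ (le_trans (re j Jj) e_eps)) _.
    exact: subset_refl.
  apply: le_lt_trans (hausdorff_pre_cylinders_le _ _ _ Cj01 _) _.
  - exact: ltW.
  - exact: ltW.
  - by rewrite r0 (le_lt_trans (re j Jj)).
  - by rewrite le_max lexx.
  rewrite SM -EFinM lte_fin mulrAC ltr_pM2r ?powR_gt0//.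
  by rewrite ltrDl.
apply: le_trans (_ : _ <= \esum_(j in J) (L%:E * ((diam (C j) `^ a)%:E + (w j)%:E)))%E _.
  by apply: le_esum => j _; rewrite -EFinD -EFinM lee_fin ler_pM2l.
rewrite esumZl_nat; [|exact: ltW|]; last first.
  by move=> j; rewrite -EFinD lee_fin addr_ge0 ?powR_ge0// ltW.
rewrite esumD; [|by move=> j _; rewrite lee_fin powR_ge0|
  by move=> j _; rewrite lee_fin ltW].
have -> : eta%:E = (L%:E * (h%:E + h%:E))%E.
  by rewrite -EFinD -EFinM; congr EFin; rewrite /h; field; rewrite gt_eqF.
rewrite lee_pmul2l//; apply: leeD; first exact: ltW.
apply: le_trans (epsilon_trick0 xpredT (ltW h0)).
rewrite esum_mkcond nneseries_esumT; last by move=> j; exact: ltW (w0 j).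
by apply: le_esum => j _; case: ifP => // _; exact: ltW (w0 j).
Qed.

End Comparison.

(** * The theorem *)

Theorem theorem2p1 (R : realType) (s : nat) (q : 'I_s -> nat -> R)
  (hs : (2 <= s)%N)
  (q_gt0 : forall i k, (1 <= k)%N -> 0 < q i k)
  (q_sum : forall k, (1 <= k)%N -> \sum_(i < s) q i k = 1)
  (q_prod : (\prod_(1 <= k < n.+1) qmax q k) @[n --> \oo] --> (0 : R))
  (S_fin : forall d : R, 0 < d -> (Ssup q d < +oo)%E) :
  faithful_family (cylinders q).
Proof.
move=> E E01; apply/le_anti/andP; split.
  apply: ereal_inf_le_tmp => _ [a [a0 Ha] <-]; exists a => //; split=> //.
  apply/hausdorff_measure_eq0 => eps eps0; apply/eqP.
  rewrite eq_le hausdorff_pre_ge0 andbT.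
  have /hausdorff_measure_eq0/(_ eps eps0) <- := Ha.
  apply: hausdorff_pre_le => // _ [alpha [n [_ ->]]].
  exact: cylinder_sub01.
apply: le_ereal_inf_tmp => _ [a [a0 Ha] <-].
apply/lee_addgt0Pr => d d0; rewrite -EFinD.
apply: ereal_inf_lbound; exists (a + d); last by [].
split; first exact: addr_gt0.
apply: hausdorff_measure_cylinders_eq0 Ha => //; first exact: leq_trans hs.
by apply: le_lt_trans (S_fin _ d0); apply: ereal_sup_ubound; exists 0.
Qed.
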